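(* Let $G$ be a graph and let $\omega(G)$ be the order of a largest clique in $G$. Then \[ldim_{ms}(G)\ge \lceil \log_2\omega(G)\rceil \quad\text{and}\quad lmd(G)\ge \lceil\log_2\omega(G)\rceil.\] Moreover, for every integer $n\ge 2$ there exists a graph $G$ with $\omega(G)=n$ such that $ldim_{ms}(G)=lmd(G)=\lceil\log_2 n\rceil$.
   Context: All graphs are finite, connected, undirected and simple; $d(u,v)$ is the distance between $u$ and $v$. For a nonempty set $W\subseteq V(G)$ and a vertex $u\in V(G)$, the representation multiset $m(u|W)$ is the multiset of the distances $d(u,w)$, $w\in W$. $W$ is a local multiset resolving set of $G$ if $m(u|W)\neq m(v|W)$ for every two adjacent vertices $u,v$ of $G$; the smallest cardinality of such a set is the local multiset dimension $lmd(G)$, which is infinite if no such set exists. $W$ is a local outer multiset resolving set of $G$ if $m(u|W)\neq m(v|W)$ for every two adjacent vertices $u,v$ in $V(G)\setminus W$; the smallest cardinality of such a set is the local outer multiset dimension $ldim_{ms}(G)$. *)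

(* Defs.v *)
From mathcomp Require Import all_boot finmap multiset.

Set Implicit Arguments.
Unset Strict Implicit.
Unset Printing Implicit Defensive.

Local Open Scope mset_scope.

Record graph := Graph {
  vertex :> finType;
  adj : rel vertex;
  adj_sym : symmetric adj;
  adj_irr : irreflexive adj;
  adj_connected : forall u v : vertex, connect adj u v;
  vertex_nonempty : 0 < #|vertex|
}.

Arguments adj {g} : rename.

Section Dimensions.

Variable G : graph.
Implicit Types (u v w : G) (W K : {set G}).

Definition walk n u v : bool :=
  [exists p : n.-tuple G, path adj u p && (last u p == v)].

Lemma walk_exists u v : exists n, walk n u v.
Proof.
have /connectP [p e_p ->] := adj_connected u v.
by exists (size p); apply/existsP; exists (in_tuple p); rewrite e_p eqxx.
Qed.

Definition dist u v : nat := ex_minn (walk_exists u v).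

Definition clique K : bool :=
  [forall u in K, forall v in K, (u != v) ==> adj u v].

Definition clique_number : nat := \max_(K : {set G} | clique K) #|K|.

(* [seq _ | w in W] lists each w in W once, so multiplicities are kept. *)
Definition repr_mset u W : {mset nat} := seq_mset [seq dist u w | w in W].

Definition local_resolving W : bool :=
  (W != set0) &&
  [forall u, forall v, adj u v ==> (repr_mset u W != repr_mset v W)].

Definition local_outer_resolving W : bool :=
  (W != set0) &&
  [forall u in ~: W, forall v in ~: W,
     adj u v ==> (repr_mset u W != repr_mset v W)].

(* None stands for infinity. *)
Definition lmd : option nat :=
  if [pick W | local_resolving W] is Some W0
  then Some #|[arg min_(W < W0 | local_resolving W) #|W|]|
  else None.

(* The whole vertex set is always a local outer resolving set (see below), so
   the default value of arg min is legitimate and this dimension is finite. *)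
Definition ldim_ms : nat :=
  #|[arg min_(W < [set: G] | local_outer_resolving W) #|W|]|.

Lemma local_outer_resolvingT : local_outer_resolving [set: G].
Proof.
apply/andP; split; first by rewrite -card_gt0 cardsT vertex_nonempty.
by apply/forall_inP => u; rewrite !inE.
Qed.

Lemma ldim_msP :
  (exists2 W, local_outer_resolving W & #|W| = ldim_ms) /\
  (forall W, local_outer_resolving W -> ldim_ms <= #|W|).
Proof.
rewrite /ldim_ms; case: arg_minnP => [|W rW minW].
  exact: local_outer_resolvingT.
by split; first exists W.
Qed.

Lemma lmdP k :
  lmd = Some k <->
  (exists2 W, local_resolving W & #|W| = k) /\
  (forall W, local_resolving W -> k <= #|W|).
Proof.
rewrite /lmd; case: pickP => [W0 rW0 | noW].
  case: arg_minnP => // W rW minW; split=> [[<-]|[[W' rW' <-] minW']].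
    by split; first exists W.
  by congr Some; apply/eqP; rewrite eqn_leq minW //= minW'.
by split=> // -[[W]]; rewrite noW.
Qed.

Lemma lmd_infP : lmd = None <-> forall W, ~~ local_resolving W.
Proof.
rewrite /lmd; case: pickP => [W0 rW0 | noW].
  by split=> // /(_ W0); rewrite rW0.
by split=> // _ W; rewrite noW.
Qed.

End Dimensions.

Definition leq_inf (n : nat) (d : option nat) : bool :=
  if d is Some k then n <= k else true.

(* Main.v *)
Require Import Defs.
From mathcomp Require Import all_boot finmap multiset zify.

Set Implicit Arguments.
Unset Strict Implicit.
Unset Printing Implicit Defensive.

(** The lower bound rests on parity.  Adjacent vertices [u], [v] have distances
    to a landmark [w] differing by at most one, so these distances are equal as
    soon as they have the same parity.  Send a vertex of a clique [K] to the set
    of landmarks of [W] at odd distance from it.  If two vertices of [K] had the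
    same image, they would have the same distance to every landmark; this makes
    their representation multisets equal, and also excludes that one of them is
    itself a landmark, since it is at distance [0] from itself and [1] from the
    other.  So neither kind of resolving set tolerates a collision
    ([same_parity_dist], [card_clique_resolving]), and [#|K| <= 2 ^ #|W|].

    For sharpness put [k := up_log 2 n] and label the [n] vertices of a complete
    graph by distinct subsets of ['I_k], among them the empty and the full set;
    this is possible because [2 <= n <= 2 ^ k].  For each [i] attach a pendant
    path with [2 i + 1] vertices, whose first vertex is joined to the clique
    vertices having [i] in their label; the landmark [i] is the last vertex of
    that path.  A clique vertex is at distance [2 i + 1] or [2 i + 2] from it
    according as [i] is in its label or not, so the label can be read off the
    odd values of its multiset of distances.  On the paths, the distances from a
    given vertex to all the landmarks have the same parity, which alternates
    along the path and is even at the first vertex: this separates neighbouring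
    path vertices, and a first vertex from its clique neighbours, which have an
    odd distance.  The full label makes all these distances come out exactly,
    and the paths do not enlarge the clique number because they can be coloured
    with the two labels set0 and setT ([colour_proper]). *)

(** * Distances *)

Section Distance.

Variable G : graph.
Implicit Types (u v w : G) (W K : {set G}).

Lemma dist_path_le u p : path adj u p -> dist u (last u p) <= size p.
Proof.
move=> e_p; rewrite /dist; case: ex_minnP => m _ min_m; apply: min_m.
by apply/existsP; exists (in_tuple p); rewrite e_p eqxx.
Qed.

Lemma dist_pathP u v :
  exists2 p, path adj u p & last u p = v /\ size p = dist u v.
Proof.
rewrite /dist; case: ex_minnP => m /existsP[p /andP[e_p /eqP lp]] _.
by exists p; rewrite ?size_tuple.
Qed.

Lemma distxx u : dist u u = 0.
Proof. by apply/eqP; rewrite -leqn0 (@dist_path_le u [::]). Qed.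

Lemma dist_eq0 u v : (dist u v == 0) = (u == v).
Proof.
apply/idP/eqP => [/eqP d0|->]; last by rewrite distxx.
by have [p _ [lp]] := dist_pathP u v; rewrite d0 -lp => /size0nil->.
Qed.

Lemma dist_adj_le u v w : adj u v -> dist u w <= (dist v w).+1.
Proof.
move=> uv; have [p e_p [lp <-]] := dist_pathP v w; rewrite -lp.
by apply: (@dist_path_le u (v :: p)); rewrite /= uv.
Qed.

Lemma same_parity_dist u v w :
  adj u v -> odd (dist u w) = odd (dist v w) -> dist u w = dist v w.
Proof.
move=> uv; have := dist_adj_le w uv; rewrite adj_sym in uv.
by have := dist_adj_le w uv; lia.
Qed.

Lemma eq_repr_mset u v W :
  {in W, forall w, dist u w = dist v w} -> repr_mset u W = repr_mset v W.
Proof.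
move=> duv; congr seq_mset; apply/eq_in_map => w.
by rewrite mem_enum; apply: duv.
Qed.

Lemma mem_repr_mset u W d :
  (d \in repr_mset u W) = [exists w in W, dist u w == d].
Proof.
rewrite /repr_mset (perm_mem (perm_eq_seq_mset _)).
apply/mapP/exists_inP => [[w Ww ->]|[w Ww /eqP<-]].
  by exists w; rewrite // -mem_enum.
by exists w; rewrite ?mem_enum.
Qed.

End Distance.

(** * The lower bounds *)

Section LowerBounds.

Variable G : graph.
Implicit Types (u v w : G) (W K : {set G}).

Lemma local_resolving_outer W : local_resolving W -> local_outer_resolving W.
Proof.
case/andP=> W0 /forallP rW; rewrite /local_outer_resolving W0.
apply/forall_inP => u _; apply/forall_inP => v _.
exact: (forallP (rW u)).
Qed.

(** Distinct clique vertices outside [W] are separated by the parities because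
    [W] resolves them, and a clique vertex in [W] is separated from the others
    by its own coordinate. *)
Lemma card_clique_resolving W K :
  local_outer_resolving W -> clique K -> #|K| <= 2 ^ #|W|.
Proof.
move=> /andP[_ rW] cK; pose code u := [set w in W | odd (dist u w)].
have codeW u : code u \in powerset W.
  by rewrite inE; apply/subsetP=> w; rewrite inE => /andP[].
suff code_inj : {in K &, injective code}.
  rewrite -card_powerset -(card_in_imset code_inj).
  by apply/subset_leq_card/subsetP => _ /imsetP[u _ ->].
move=> u v Ku Kv code_uv; apply: contraTeq isT => neq_uv.
have uv : adj u v.
  by have /forall_inP/(_ _ Ku)/forall_inP/(_ _ Kv)/implyP := cK; apply.
have duv : {in W, forall w, dist u w = dist v w}.
  move=> w Ww; apply: same_parity_dist => //.
  by have /setP/(_ w) := code_uv; rewrite !inE Ww.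
(* A landmark is the only vertex at distance [0] from itself. *)
have outside x y :
    x != y -> {in W, forall w, dist x w = dist y w} -> x \in ~: W.
  move=> neq_xy dxy; rewrite inE; apply: contra neq_xy => /dxy/eqP.
  by rewrite distxx eq_sym dist_eq0 eq_sym.
have Wu := outside _ _ neq_uv duv.
have Wv : v \in ~: W.
  by apply: (outside v u); rewrite 1?eq_sym // => w /duv.
have /forall_inP/(_ _ Wu)/forall_inP/(_ _ Wv) := rW.
by rewrite uv (eq_repr_mset duv) eqxx.
Qed.

Lemma up_log_clique_resolving W :
  local_outer_resolving W -> up_log 2 (clique_number G) <= #|W|.
Proof.
move=> rW; apply: up_log_min => //.
by apply/bigmax_leqP => K; apply: card_clique_resolving.
Qed.

Lemma up_log_clique_ldim_ms : up_log 2 (clique_number G) <= ldim_ms G.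
Proof. by have [[W rW <-] _] := ldim_msP G; apply: up_log_clique_resolving. Qed.

Lemma up_log_clique_lmd : leq_inf (up_log 2 (clique_number G)) (lmd G).
Proof.
case lmdG: (lmd G) => [m|] //=; have [[W rW <-] _] := (lmdP G m).1 lmdG.
exact/up_log_clique_resolving/local_resolving_outer.
Qed.

Lemma dimensions_sharp W :
  local_resolving W -> #|W| = up_log 2 (clique_number G) ->
  ldim_ms G = #|W| /\ lmd G = Some #|W|.
Proof.
move=> rW cW; split.
  have [_ /(_ W (local_resolving_outer rW)) le] := ldim_msP G.
  by apply/eqP; rewrite eqn_leq le cW up_log_clique_ldim_ms.
apply/lmdP; split; first by exists W.
by move=> W' /local_resolving_outer; rewrite cW; apply: up_log_clique_resolving.
Qed.

End LowerBounds.

(** * Certifying distances by a potential *)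

(** Stated for a bare relation because it also provides the connectedness that
    is needed to build the extremal graphs. *)
Lemma descent_path (T : finType) (e : rel T) (f : T -> nat) (w : T) :
    (forall u, u != w -> exists2 v, e u v & f u = (f v).+1) ->
  forall u, exists2 p, path e u p & last u p = w /\ size p <= f u.
Proof.
move=> desc u; move fu: (f u) => m; elim: m u fu => [|m IH] u fu.
  have [->|/desc[v _]] := eqVneq u w; last by rewrite fu.
  by exists [::].
have [->|/desc[v uv]] := eqVneq u w; first by exists [::].
rewrite fu => -[/esym/IH[p e_p [lp sp]]].
by exists (v :: p); rewrite /= ?uv.
Qed.

(** A Lipschitz function is at most the distance, and descending along it
    gives a path that is no longer than its value. *)
Lemma dist_potential (G : graph) (f : G -> nat) (w : G) :
    f w = 0 -> (forall u v, adj u v -> f u <= (f v).+1) ->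
    (forall u, u != w -> exists2 v, adj u v & f u = (f v).+1) ->
  forall u, dist u w = f u.
Proof.
move=> fw lip /descent_path desc u; apply/eqP; rewrite eqn_leq.
apply/andP; split.
  by have [p e_p [<- sp]] := desc u; apply: leq_trans (dist_path_le e_p) sp.
have [p e_p [lp <-]] := dist_pathP u w.
elim: p u e_p lp => [|v p IH] u /=; first by move=> _ ->; rewrite fw.
by case/andP=> /lip le_uv e_p lp; apply: leq_trans le_uv _; rewrite ltnS IH.
Qed.

(** * The extremal graphs *)

Section Construction.

Variables (k : nat) (F : {set {set 'I_k}}).
Hypotheses (k_gt0 : 0 < k) (F0 : set0 \in F) (FT : setT \in F).

Definition label := {A : {set 'I_k} | A \in F}.

(** The last index of path [i] is [i.*2], at the landmark, and index [0] is the
    end joined to the clique. *)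
Definition path_vertex := {i : 'I_k & 'I_(i.*2.+1)}.
Definition spider_vertex := (label + path_vertex)%type.

Definition pos (x : path_vertex) : nat := tagged x.
Definition full : label := exist _ setT FT.
Definition empty : label := exist _ set0 F0.

Definition spider_adj : rel spider_vertex := fun x y =>
  match x, y with
  | inl A, inl B => A != B
  | inl A, inr z | inr z, inl A => (tag z \in val A) && (pos z == 0)
  | inr z, inr t =>
      (tag z == tag t) && (((pos z).+1 == pos t) || ((pos t).+1 == pos z))
  end.

(** The intended distance to the landmark [i].  Leaving another path, one passes
    through the clique vertex labelled by the full set, which is adjacent to the
    first vertex of every path: this gives the summand [i.*2.+2]. *)
Definition height (i : 'I_k) (x : spider_vertex) : nat :=
  match x with
  | inl A => i.*2.+1 + (i \notin val A)
  | inr z => if tag z == i then i.*2 - pos z else i.*2.+2 + pos z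
  end.

Definition path_point (i : 'I_k) (p : 'I_(i.*2.+1)) : spider_vertex :=
  inr (Tagged (fun j : 'I_k => 'I_(j.*2.+1)) p).

Definition landmark (i : 'I_k) : spider_vertex := path_point (@ord_max i.*2).

Lemma spider_adj_sym : symmetric spider_adj.
Proof.
by case=> [A|z] [B|t] //=; rewrite eq_sym // orbC.
Qed.

Lemma spider_adj_irr : irreflexive spider_adj.
Proof. by case=> [A|z] /=; rewrite eqxx //= orbb gtn_eqF. Qed.

Lemma pos_le (z : path_vertex) : pos z <= (tag z).*2.
Proof. by rewrite -ltnS /pos ltn_ord. Qed.

Lemma height_landmark i : height i (landmark i) = 0.
Proof. by rewrite /= eqxx subnn. Qed.

Lemma height_lipschitz i x y : spider_adj x y -> height i x <= (height i y).+1.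
Proof.
case: x y => [A|z] [B|t] /=; first by lia.
- by case/andP=> tA /eqP->; case: eqVneq tA => [->->|_ _]; lia.
- by case/andP=> tA /eqP->; case: eqVneq tA => [->->|_ _]; lia.
by case/andP=> /eqP->; case: ifP => _; lia.
Qed.

(** One moves outwards along path [i], inwards along the other paths, and inside
    the clique to the full label, unless path [i] can be entered at once. *)
Lemma height_descent i x :
  x != landmark i -> exists2 y, spider_adj x y & height i x = (height i y).+1.
Proof.
case: x => [A _|[j p]].
  have [iA|iA] := boolP (i \in val A).
    exists (path_point (@ord0 i.*2));
      by rewrite /= ?iA ?eqxx /pos //= subn0 addn0.
  exists (inl full); rewrite /= ?iA ?inE //=; last by lia.
  by apply: contraNneq iA => ->; rewrite inE.
have p_le : p <= j.*2 by rewrite -ltnS.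
have [eq_ji|neq_ji] := eqVneq j i; last first.
  move=> _; have [p0|p_gt0] := posnP p.
    exists (inl full);
      by rewrite /= ?(negPf neq_ji) /pos /= ?p0 ?inE //= !addn0.
  exists (path_point (inord p.-1 : 'I_(j.*2.+1)));
    by rewrite /= ?eqxx ?(negPf neq_ji) /pos /= inordK; lia.
case: i / eq_ji => neq_p; have p_lt : p < j.*2.
  rewrite ltn_neqAle p_le andbT; apply: contra neq_p => /eqP pj.
  by have -> : p = ord_max; [apply: val_inj | rewrite eqxx].
exists (path_point (inord p.+1 : 'I_(j.*2.+1)));
  by rewrite /= ?eqxx /pos /= inordK; lia.
Qed.

Lemma spider_connected x y : connect spider_adj x y.
Proof.
have to_root z : connect spider_adj z (landmark (Ordinal k_gt0)).
  have [p e_p [lp _]] := descent_path (height_descent (i := Ordinal k_gt0)) z.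
  by apply/connectP; exists p.
apply: connect_trans (to_root x) _.
by rewrite (sym_connect_sym spider_adj_sym) to_root.
Qed.

Lemma spider_nonempty : 0 < #|{: spider_vertex}|.
Proof. by apply/card_gt0P; exists (inl full). Qed.

Definition spider : graph :=
  Graph spider_adj_sym spider_adj_irr spider_connected spider_nonempty.

Definition landmarks : {set spider} := [set landmark i | i : 'I_k].

Lemma dist_landmark (x : spider) i : dist x (landmark i : spider) = height i x.
Proof.
apply: (@dist_potential spider (height i)); first exact: height_landmark.
- exact: height_lipschitz.
- exact: height_descent.
Qed.

Lemma card_landmarks : #|landmarks| = k.
Proof.
rewrite card_imset ?card_ord // => i j /(congr1 (height i)).
rewrite height_landmark /=.
by case: eqVneq => [->|_ /esym/eqP].
Qed.

Lemma mem_repr_landmarks (x : spider) d :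
  (d \in repr_mset x landmarks) = [exists i, height i x == d].
Proof.
rewrite mem_repr_mset; apply/exists_inP/existsP.
  by case=> _ /imsetP[i _ ->]; rewrite dist_landmark; exists i.
by case=> i; exists (landmark i); rewrite ?imset_f ?dist_landmark.
Qed.

(** On the clique the distance to landmark [j] is [j.*2.+1] or [j.*2.+2]; only
    [j = i] can produce the odd value [i.*2.+1], so distances to different
    landmarks never get mixed up in the multiset. *)
Lemma label_value (A : label) (i : 'I_k) :
  (i.*2.+1 \in repr_mset (inl A : spider) landmarks) = (i \in val A).
Proof.
rewrite mem_repr_landmarks; apply/existsP/idP => [[j] /= |iA].
  case: (boolP (j \in val A)) => [jA|_] /= /eqP; last by lia.
  by move=> ij; have -> : i = j by apply: val_inj => /=; lia.
by exists i; rewrite /= iA addn0.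
Qed.

(** The first vertex of a path is at even distance from every landmark, because
    all the paths have an even number of edges, and one step along the path
    changes all the distances by one. *)
Lemma path_value_odd (z : path_vertex) d :
  d \in repr_mset (inr z : spider) landmarks -> odd d = odd (pos z).
Proof.
rewrite mem_repr_landmarks => /existsP[i /= /eqP <-].
by have := pos_le z; case: eqVneq => [->|_]; lia.
Qed.

(** Neighbours are told apart by an odd value that occurs in only one of their
    multisets, or, on a path, by the common parity of the values. *)
Lemma landmarks_resolving : local_resolving landmarks.
Proof.
apply/andP; split; first by rewrite -card_gt0 card_landmarks.
have mixed (A : label) z : spider_adj (inl A) (inr z) ->
    repr_mset (inl A : spider) landmarks
      != repr_mset (inr z : spider) landmarks.
  case/andP=> zA /eqP z0; apply/eqP => eq_m.
  have := label_value A (tag z); rewrite eq_m zA => /path_value_odd.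
  by rewrite z0 /= odd_double.
apply/forallP=> x; apply/forallP=> y; apply/implyP.
case: x y => [A|z] [B|t] // e_xy.
- apply: contra e_xy => /eqP eq_m; apply/eqP/val_inj/setP => i.
  by rewrite -!label_value eq_m.
- exact: mixed.
- by rewrite eq_sym; apply: mixed.
apply/eqP => eq_m.
have hm : height (Ordinal k_gt0) (inr z)
    \in repr_mset (inr z : spider) landmarks.
  by rewrite mem_repr_landmarks; apply/existsP; exists (Ordinal k_gt0).
have := path_value_odd hm; rewrite eq_m in hm; rewrite (path_value_odd hm).
by case/andP: e_xy => _; lia.
Qed.

(** A proper colouring whose colours are the labels bounds the clique number by
    the number of labels.  The first vertex of a path is adjacent only to
    nonempty labels and to the second vertex of its path, so it can take the
    empty label. *)
Definition colour (x : spider) : label :=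
  match x with
  | inl A => A
  | inr z => if odd (pos z) then full else empty
  end.

Lemma colour_proper (x y : spider) : adj x y -> colour x != colour y.
Proof.
have full_empty : full != empty.
  by apply/eqP => /(congr1 val)/setP/(_ (Ordinal k_gt0)); rewrite !inE.
have mixed (A : label) z : spider_adj (inl A) (inr z) -> A != colour (inr z).
  by case/andP=> zA /eqP /= ->; apply: contraTneq zA => ->; rewrite inE.
case: x y => [A|z] [B|t] // e_xy; first exact: mixed.
  by rewrite eq_sym; apply: mixed.
have : odd (pos z) != odd (pos t) by case/andP: e_xy => _; lia.
rewrite /=; case: (odd (pos z)); case: (odd (pos t)) => // _.
by rewrite eq_sym.
Qed.

Lemma clique_number_spider : clique_number spider = #|F|.
Proof.
have card_label : #|{: label}| = #|F| by rewrite card_sig; apply: eq_card.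
apply/eqP; rewrite eqn_leq -card_label; apply/andP; split.
  apply/bigmax_leqP => K cK; apply: (@leq_card_in _ _ colour).
  move=> x y Kx Ky; apply: contra_eq => neq_xy; apply: colour_proper.
  by have /forall_inP/(_ _ Kx)/forall_inP/(_ _ Ky)/implyP := cK; apply.
have inl_inj : injective (inl : label -> spider) by move=> ? ? [].
rewrite -(card_imset _ inl_inj).
apply: (leq_bigmax_cond (F := fun K : {set spider} => #|K|)).
apply/forall_inP => _ /imsetP[A _ ->]; apply/forall_inP => _ /imsetP[B _ ->].
by apply/implyP.
Qed.

End Construction.

(** * Choosing the labels *)

Lemma subset_of_card (T : finType) (A : {set T}) m :
  #|A| <= m <= #|T| -> exists2 B : {set T}, A \subset B & #|B| = m.
Proof.
case/andP=> leAm lemT.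
have /card_geqP[s [us ss sA]] : m - #|A| <= #|~: A|.
  by rewrite -(cardsC A) in lemT; lia.
exists (A :|: [set x in s]); first exact: subsetUl.
have dis : A :&: [set x in s] = set0.
  apply/setP => x; rewrite !inE; apply/negP => /andP[Ax /sA].
  by rewrite inE Ax.
rewrite cardsU dis cards0 subn0 cardsE (card_uniqP us) ss.
by lia.
Qed.

Theorem theorem11 :
  (forall G : graph,
     up_log 2 (clique_number G) <= ldim_ms G /\
     leq_inf (up_log 2 (clique_number G)) (lmd G)) /\
  (forall n : nat, 2 <= n ->
     exists G : graph,
       [/\ clique_number G = n,
           ldim_ms G = up_log 2 n
         & lmd G = Some (up_log 2 n)]).
Proof.
split=> [G|n n_ge2].
  by split; [apply: up_log_clique_ldim_ms | apply: up_log_clique_lmd].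
pose k := up_log 2 n; have k_gt0 : 0 < k by rewrite up_log_gt0.
have [F sF cF] : exists2 F : {set {set 'I_k}},
    [set set0; setT] \subset F & #|F| = n.
  apply: subset_of_card; apply/andP; split.
    by rewrite cards2; apply: leq_trans n_ge2; case: (_ != _).
  by rewrite -cardsT -powersetT card_powerset cardsT card_ord up_logP.
have F0 : set0 \in F by rewrite (subsetP sF) // !inE eqxx.
have FT : setT \in F by rewrite (subsetP sF) // !inE eqxx orbT.
have cW := card_landmarks k_gt0 F0 FT.
have omega := clique_number_spider k_gt0 F0 FT.
have := dimensions_sharp (landmarks_resolving k_gt0 F0 FT).
rewrite cW omega cF => /(_ erefl)[dim lmd_eq].
by exists (spider k_gt0 F0 FT); split; rewrite ?omega.
Qed.
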